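(* There exists a universal constant $C$ such that the following holds. Let $G=(V,E,J)$ be a weighted graph, let $\beta \geq 0$, and suppose that there exist constants $A<\infty$ and $0 \leq \theta \leq 1/2$ such that $\mathbf{P}_\beta( |K_u| \geq \lambda) \leq A \lambda^{-\theta}$ for every $u\in V$ and $\lambda>0$. Then \[ \frac{1}{|\Lambda|}\sum_{v \in \Lambda} \mathbf{P}_\beta(u\leftrightarrow v) \leq C A^{2 /(1+\theta)} |\Lambda|^{-2\theta/(1+\theta)} \] for every $u\in V$ and every finite non-empty set $\Lambda \subseteq V$.
   Context: A weighted graph $G=(V,E,J)$ is a countable graph $(V,E)$ together with positive weights $\{J_e:e\in E\}$ such that for each $v\in V$ the sum of $J_e$ over edges $e$ incident to $v$ is finite. For $\beta\ge 0$, $\mathbf{P}_\beta$ is the law of Bernoulli-$\beta$ bond percolation on $G$, in which each edge $e$ is retained independently with probability $1-e^{-\beta J_e}$ and otherwise deleted. Clusters are the connected components of the resulting random subgraph; $K_u$ is the cluster of $u$, $|K_u|$ its number of vertices, and $\{u\leftrightarrow v\}$ is the event that $u$ and $v$ are in the same cluster. *)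

(* Defs.v *)
From HB Require Import structures.
From mathcomp Require Import all_boot all_order all_algebra finmap.
From mathcomp Require Import all_classical all_reals all_analysis.

Set Implicit Arguments.
Unset Strict Implicit.
Unset Printing Implicit Defensive.

Import Order.TTheory GRing.Theory Num.Theory.
Local Open Scope classical_set_scope.
Local Open Scope ring_scope.

(* Edges form a type of their own, [ends e] listing the endpoints of [e] in an
   arbitrary order: parallel edges and loops are allowed, and a simple graph is
   the case where [ends] is injective up to swapping and never diagonal. *)
Definition incident (V E : Type) (ends : E -> V * V) (v : V) : set E :=
  [set e | (ends e).1 = v \/ (ends e).2 = v].

Record weighted_graph (R : realType) := WeightedGraph {
  vertex : countType;
  edge : countType;
  ends : edge -> vertex * vertex;
  weight : edge -> R;
  weight_gt0 : forall e, 0 < weight e;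
  weight_summable : forall v : vertex,
    (\esum_(e in incident ends v) (weight e)%:E < +oo)%E
}.

(* {0,1}^E with the product sigma-algebra. *)
Definition config (E : Type) :=
  g_sigma_algebraType [set A : set (E -> bool) | exists e, A = [set w : E -> bool | w e]].

Section Percolation.
Context {R : realType}.
Variable G : weighted_graph R.

Definition edge_open (e : edge G) : set (config (edge G)) :=
  [set w : config (edge G) | w e : bool].

(* Independence is mutual: the product rule over every finite set of edges. *)
Definition bernoulli_percolation (beta : R)
    (P : probability (config (edge G)) R) : Prop :=
  (forall e, P (edge_open e) = (1 - expR (- (beta * weight e)))%:E) /\
  (forall S : {fset edge G},
    P (\bigcap_(e in [set` S]) edge_open e) =
    (\prod_(e <- S) P (edge_open e))%E).

Definition open_adj (w : config (edge G)) (x y : vertex G) : Prop :=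
  exists2 e, w e & ends e = (x, y) \/ ends e = (y, x).

Definition connected_in (w : config (edge G)) (u v : vertex G) : Prop :=
  exists2 p : seq (vertex G),
    path (fun x y => `[< open_adj w x y >]) u p & last u p = v.

Definition cluster (w : config (edge G)) (u : vertex G) : set (vertex G) :=
  [set v | connected_in w u v].

(* [counting] is the cardinality, +oo on infinite sets. *)
Definition cluster_ge (u : vertex G) (lam : R) : set (config (edge G)) :=
  [set w | (lam%:E <= counting (cluster w u))%E].

Definition connected_event (u v : vertex G) : set (config (edge G)) :=
  [set w | connected_in w u v].

End Percolation.

(* Main.v *)
Require Import Defs.
From HB Require Import structures.
From mathcomp Require Import all_boot all_order all_algebra finmap.
From mathcomp Require Import all_classical all_reals all_analysis.
From mathcomp Require Import ring lra zify.

Set Implicit Arguments.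
Unset Strict Implicit.
Unset Printing Implicit Defensive.

Import Order.TTheory GRing.Theory Num.Theory.
Local Open Scope classical_set_scope.
Local Open Scope ring_scope.

(** Write [f t = P (|K_u ∩ Λ| >= t)] and [g t = P (exists v, |K_v ∩ Λ| >= t)].
    An open cluster with at least [3 t] points of [Λ] contains two
    edge-disjoint connected subgraphs with at least [t] points of [Λ] each, one
    of them containing [u], so the van den Berg-Kesten inequality gives
    [f (3 t) <= f t * g t].  If some cluster has [t] points in [Λ], then all of
    these see a large cluster, so [t * g t <= |Λ| A t^(-theta)] and hence
    [g t <= 1/6] for [t >= M = (6 A |Λ|)^(1/(1+theta))].  Therefore
    [sum_(t >= 3M) f t <= 3 sum_(s >= M) f (3 s) <= (1/2) sum_t f t], and the
    expectation [sum_t f t] of [|K_u ∩ Λ|] is at most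
    [2 sum_(t < 3M) A t^(-theta)], of order [A M^(1-theta)].  This is done on
    finite subgraphs, whose clusters are smaller, and the bound passes to the
    limit. *)

(** * Product measure on a finite list and the van den Berg-Kesten inequality *)

Section FiniteProduct.
Context {R : realType} {E : eqType}.
Variable p : E -> R.
Hypothesis p01 : forall e, 0 <= p e <= 1.

(** Expectation of [f] at the random sublist of [s] that keeps each [e] independently with
    probability [p e]. A configuration is the list of its open elements, which allows conditioning
    on the head of [s]. *)
Fixpoint avg (s : seq E) (f : seq E -> R) : R :=
  if s is e :: s' then
    (1 - p e) * avg s' f + p e * avg s' (fun w => f (e :: w))
  else f [::].

Lemma avgD s f g : avg s (fun w => f w + g w) = avg s f + avg s g.
Proof. by elim: s f g => //= e s IH f g; rewrite !IH; ring. Qed.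

Lemma avgZ s c f : avg s (fun w => c * f w) = c * avg s f.
Proof. by elim: s f => //= e s IH f; rewrite !IH; ring. Qed.

Lemma avg_cst s c : avg s (fun=> c) = c.
Proof. by elim: s => //= e s IH; rewrite !IH; ring. Qed.

Lemma avg_sum (I : Type) (r : seq I) (Q : pred I) s (f : I -> seq E -> R) :
  avg s (fun w => \sum_(i <- r | Q i) f i w) = \sum_(i <- r | Q i) avg s (f i).
Proof.
elim: s f => //= e s IH f.
by rewrite !IH !mulr_sumr -big_split.
Qed.

Lemma le_avg s f g : (forall w, f w <= g w) -> avg s f <= avg s g.
Proof.
elim: s f g => [|e s IH] f g fg /=; first exact: fg.
have /andP[p0 p1] := p01 e.
by rewrite lerD// ler_wpM2l ?subr_ge0 ?IH.
Qed.

Definition prob (s : seq E) (A : pred (seq E)) := avg s (fun w => (A w)%:R).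

Lemma le_prob s (A B : pred (seq E)) : subpred A B -> prob s A <= prob s B.
Proof.
move=> AB; apply: le_avg => w; rewrite ler_nat.
by case: (A w) (AB w) => // ->.
Qed.

Lemma prob_ge0 s A : 0 <= prob s A.
Proof. by rewrite -[leLHS](avg_cst s 0); apply: le_avg => w; exact: ler0n. Qed.

Definition increasing (A : pred (seq E)) :=
  forall w w', subseq w w' -> A w -> A w'.

(* [A] and [B] occur on disjoint sublists of [w]: each element of [w] in turn
   is given to one of the two. *)
Fixpoint disjoint_occ (A B : pred (seq E)) (w : seq E) : bool :=
  if w is e :: w' then
    disjoint_occ (A \o cons e) B w' || disjoint_occ A (B \o cons e) w'
  else A [::] && B [::].

Lemma sub_disjoint_occ (A A' B B' : pred (seq E)) :
  subpred A A' -> subpred B B' ->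
  subpred (disjoint_occ A B) (disjoint_occ A' B').
Proof.
move=> AA BB w; elim: w A A' B B' AA BB => [|e w IH] A A' B B' AA BB /=.
  by move=> /andP[/AA -> /BB ->].
case/orP => H; apply/orP; [left|right]; apply: IH H => // w' /=.
- exact: AA.
- exact: BB.
Qed.

Lemma disjoint_occ_filter (A B : pred (seq E)) (d : pred E) w :
  A [seq e <- w | d e] -> B [seq e <- w | ~~ d e] -> disjoint_occ A B w.
Proof.
elim: w A B => [|e w IH] A B /=; first by move=> -> ->.
by case: (d e) => /= Ad Bd; apply/orP; [left|right]; apply: IH.
Qed.

Lemma increasing_cons A e : increasing A -> increasing (A \o cons e).
Proof. by move=> iA w w' ww /=; apply: iA; rewrite /= eqxx. Qed.

Lemma sub_increasing_cons A e : increasing A -> subpred A (A \o cons e).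
Proof. by move=> iA w /=; apply: iA; exact: subseq_cons. Qed.

(* Conditioning on the first element, the union of the two ways to assign it
   is bounded both by inclusion-exclusion and by giving it to both events; the
   convex combination of the two bounds is exactly the product. *)
Lemma van_den_berg_kesten s A B : increasing A -> increasing B ->
  prob s (disjoint_occ A B) <= prob s A * prob s B.
Proof.
elim: s A B => [|e s IH] A B iA iB; first by rewrite /prob/= -natrM mulnb.
have := @increasing_cons _ e iA; have := @increasing_cons _ e iB.
have := @sub_increasing_cons _ e iA; have := @sub_increasing_cons _ e iB.
rewrite /prob /= -!/(prob _ _).
set A1 := A \o cons e; set B1 := B \o cons e => sB sA iB1 iA1.
rewrite -/(prob s (fun w => disjoint_occ A1 B w || disjoint_occ A B1 w)).
set x := prob s (fun w => _ || _).
have x11 : x <= prob s (disjoint_occ A1 B1).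
  by apply: le_prob => w /orP[]; apply: sub_disjoint_occ.
have xie : x + prob s (disjoint_occ A B) <=
    prob s (disjoint_occ A1 B) + prob s (disjoint_occ A B1).
  rewrite /x /prob -!avgD; apply: le_avg => w; rewrite -!natrD ler_nat.
  have := @sub_disjoint_occ A A1 B B sA (fun _ => id) w.
  have := @sub_disjoint_occ A A B B1 (fun _ => id) sB w.
  case: (disjoint_occ A B w) => [-> // -> //|_ _].
  by case: (disjoint_occ A1 B w); case: (disjoint_occ A B1 w).
have H00 := IH _ _ iA iB; have H01 := IH _ _ iA iB1.
have H10 := IH _ _ iA1 iB; have H11 := IH _ _ iA1 iB1.
have /andP[p0 p1] := p01 e.
have q0 : 0 <= 1 - p e by rewrite subr_ge0.
change (prob s (fun w => A (e :: w))) with (prob s A1).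
change (prob s (fun w => B (e :: w))) with (prob s B1).
move: (prob s A) (prob s B) (prob s A1) (prob s B1) H00 H01 H10 H11
  => a b a1 b1 H00 H01 H10 H11.
(* Write [p] for [p e], [q] for [1 - p], and [y] for the probability of [disjoint_occ A B]. The left
   side [q y + p x] equals [q^2 y + p q (x + y) + p^2 x], to be compared term by term with
   [(q a + p a1) (q b + p b1)]. *)
have e1 := ler_wpM2l (mulr_ge0 q0 q0) H00.
have e2 := ler_wpM2l (mulr_ge0 p0 q0) (le_trans xie (lerD H10 H01)).
have e3 := ler_wpM2l (mulr_ge0 p0 p0) (le_trans x11 H11).
nra.
Qed.

End FiniteProduct.

(** * Connectivity, and splitting a large cluster in two *)

Section Connectivity.
Context {R : realType} {G : weighted_graph R}.
Implicit Types (d : edge G -> bool) (x y z : vertex G).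

Lemma open_adjC d x y : open_adj d x y -> open_adj d y x.
Proof. by move=> [e de [xy|yx]]; exists e => //; [right|left]. Qed.

Lemma connected_refl d x : connected_in d x x.
Proof. by exists [::]. Qed.

Lemma connected_trans d y x z :
  connected_in d x y -> connected_in d y z -> connected_in d x z.
Proof.
move=> [p pp <-] [q pq <-]; exists (p ++ q); last by rewrite last_cat.
by rewrite cat_path pp.
Qed.

Lemma connected_adj d x y : open_adj d x y -> connected_in d x y.
Proof. by move=> xy; exists [:: y] => //=; rewrite andbT; exact/asboolP. Qed.

Lemma connected_step d y x z :
  connected_in d x y -> open_adj d y z -> connected_in d x z.
Proof. by move=> xy yz; apply: connected_trans xy _; exact: connected_adj. Qed.

Lemma connected_ind d x (Q : vertex G -> Prop) : Q x ->
  (forall y z, Q y -> open_adj d y z -> Q z) ->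
  forall y, connected_in d x y -> Q y.
Proof.
move=> Qx QS y [p + <-]; elim/last_ind: p => //= p z IH.
by rewrite rcons_path last_rcons => /andP[/IH Qp /asboolP/QS]; apply.
Qed.

Lemma connectedC d x y : connected_in d x y -> connected_in d y x.
Proof.
move: y; apply: (@connected_ind _ _ (connected_in d ^~ x)).
  exact: connected_refl.
move=> a b ax ab; apply: connected_trans ax.
by apply: connected_adj; exact: open_adjC.
Qed.

Lemma sub_connected d d' x y : (forall e, d e -> d' e) ->
  connected_in d x y -> connected_in d' x y.
Proof.
move=> dd'; move: y; apply: (@connected_ind _ _ (connected_in d' x)).
  exact: connected_refl.
move=> a b xa [e /dd' de ab]; apply: connected_step xa _; by exists e.
Qed.

Definition cluster_count d (L : seq (vertex G)) (u : vertex G) : nat :=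
  count (fun v => `[< connected_in d u v >]) L.

Lemma le_cluster_count d d' L u : (forall e, d e -> d' e) ->
  (cluster_count d L u <= cluster_count d' L u)%N.
Proof.
by move=> dd'; apply: sub_count => v /asboolP uv; apply/asboolP;
  exact: sub_connected dd' uv.
Qed.

Lemma eq_cluster_count d L u v :
  connected_in d u v -> cluster_count d L u = cluster_count d L v.
Proof.
move=> uv; apply: eq_count => a; apply: asbool_equiv_eq; split.
- exact/connected_trans/connectedC.
- exact: connected_trans.
Qed.

Lemma cluster_count_isolated d L u : uniq L -> (forall x, ~ open_adj d u x) ->
  (cluster_count d L u <= 1)%N.
Proof.
move=> uL iso; apply: (@leq_trans (count_mem u L)); last first.
  by rewrite count_uniq_mem//; case: (u \in L).
apply: sub_count => v /asboolP.
move: v; apply: connected_ind => //= y z /eqP ->; by move/iso.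
Qed.

(** Each crossing of [e] lands on [v] or [x], so only the part of a path after its last crossing
    matters. *)
Lemma connected_remove d e v x a : ends e = (v, x) \/ ends e = (x, v) ->
  connected_in d v a ->
  connected_in (fun f => d f && (f != e)) v a \/
  connected_in (fun f => d f && (f != e)) x a.
Proof.
move=> eE; move: a; apply: connected_ind; first by left; exact: connected_refl.
move=> b c vb [f df fE]; have [fe|fe] := eqVneq f e.
  have [->|->] : c = v \/ c = x.
    by subst f; case: eE fE => -> [] [*]; subst; auto.
  - by left; exact: connected_refl.
  - by right; exact: connected_refl.
have bc : open_adj (fun f => d f && (f != e)) b c by exists f => //; rewrite df.
by case: vb => vb; [left|right]; exact: connected_step vb bc.
Qed.

(* Invariant: the edges of [w] outside [d] connect [u] to [v], and together the
   cluster of [u] outside [d] and that of [v] inside [d] are large.  While the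
   cluster of [v] inside [d] has more than [2 t] points, delete an edge of it
   at [v]: it splits in at most two clusters, one of which has at least [t]
   points, and everything but the edges of this one leaves [d]. *)
Lemma split_connected_aux (w : seq (edge G)) L t u d v :
  uniq L -> (0 < t)%N ->
  let I d := fun e => (e \in w) && ~~ d e in
  let J d := fun e => (e \in w) && d e in
  connected_in (I d) u v -> (t <= cluster_count (J d) L v)%N ->
  (3 * t <= count (fun a => `[< connected_in (I d) u a \/
                                connected_in (J d) v a >]) L)%N ->
  exists d', (t <= cluster_count (I d') L u)%N /\
             exists v', (t <= cluster_count (J d') L v')%N.
Proof.
move=> uL t0 I J; have [n] := ubnP (count d w).
elim: n d v => // n IH d v; rewrite ltnS => dn uv tv cov.
have [small|big] := leqP (cluster_count (J d) L v) (2 * t).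
  (* Of the [3 * t] points covered, the cluster of [v] holds at most [2 * t], which leaves at least
     [t] for that of [u]. *)
  exists d; split; last by exists v.
  have : (count (fun a => `[< connected_in (I d) u a \/
    connected_in (J d) v a >]) L <=
    cluster_count (I d) L u + cluster_count (J d) L v)%N.
    rewrite /cluster_count -count_predUI; apply: leq_trans (leq_addr _ _).
    by apply: sub_count => a /=; rewrite asbool_or.
  lia.
have [x [e /andP[ew de] eE]] : exists x, open_adj (J d) v x.
  by apply: contrapT => /forallNP/(cluster_count_isolated uL); lia.
pose J' := fun f => J d f && (f != e).
(* [y] is an end of [e] whose cluster keeps at least [t] points once [e] is gone: more than [2 * t]
   points are shared between the two ends. *)
have [y [z [yz vyz ty vcov]]] : exists y z, [/\ ends e = (y, z) \/ ends e = (z, y),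
    (v = y \/ v = z), (t <= cluster_count J' L y)%N &
    forall a, connected_in (J d) v a ->
      connected_in J' y a \/ connected_in J' z a].
  have vcov a := @connected_remove (J d) e v x a eE.
  have : (cluster_count (J d) L v <= cluster_count J' L v + cluster_count J' L x)%N.
    rewrite /cluster_count -count_predUI; apply: leq_trans (leq_addr _ _).
    apply: sub_count => a /asboolP /vcov H.
    by rewrite /= -asbool_or; apply/asboolP.
  have [tv'|tv'] := leqP t (cluster_count J' L v) => H.
    by exists v, x; split; auto.
  by exists x, v; split; [case: eE; auto|auto|lia|move=> a /vcov[]; auto].
(* Testing one end of [f] is enough: both ends of an edge of [J'] lie in the same cluster of
   [J']. *)
pose d' := fun f => [&& d f, f != e & `[< connected_in J' y (ends f).1 >]].
have Jd' a b f : J' f -> ends f = (a, b) \/ ends f = (b, a) ->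
    connected_in J' y a -> J d' f.
  move=> J'f fE ya; have := J'f; rewrite /J' /J /d' => /andP[/andP[-> ->] ->] /=.
  apply/asboolP; case: fE => fE; rewrite fE //=; apply: connected_step ya _.
  by exists f; auto.
have yJ a : connected_in J' y a -> connected_in (J d') y a.
  move=> ya; suff [//] : connected_in (J d') y a /\ connected_in J' y a.
  move: a ya; apply: connected_ind; first by split; exact: connected_refl.
  move=> b c [yb yb'] [f J'f bc]; split.
    by apply: connected_step yb _; exists f => //; exact: Jd' bc yb'.
  by apply: connected_step yb' _; exists f.
have II f : I d f -> I d' f.
  by rewrite /I /d' => /andP[-> /negPf ->].
have uv' := sub_connected II uv.
have e' : open_adj (I d') y z.
  by exists e => //; rewrite /I /d' ew eqxx andbF.
have uy : connected_in (I d') u y.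
  by case: vyz uv' => -> // /connected_step; apply; exact: open_adjC.
have uz : connected_in (I d') u z by exact: connected_step uy e'.
(* A walk from [z] in [J'] stays in the cluster of [u] outside [d'] until it uses an edge of [d'];
   from then on it is in the cluster of [y]. *)
have zcov a : connected_in J' z a ->
    connected_in (I d') u a \/ connected_in (J d') y a.
  move=> za; suff : connected_in (I d') u a \/ connected_in J' y a.
    by case=> [|/yJ]; auto.
  move: a za; apply: connected_ind; first by left.
  move=> b c + [f J'f bc]; case=> [ub|yb]; last first.
    by right; apply: connected_step yb _; exists f.
  case: (boolP (d' f)) => d'f; last first.
    left; apply: connected_step ub _; exists f => //; rewrite /I d'f.
    by move: J'f => /andP[/andP[->]].
  right; have /and3P[_ _ /asboolP] := d'f.
  case: bc => fE; rewrite fE //= => yb.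
  by apply: connected_step yb _; exists f; auto.
apply: (IH d' y) => //.
(* The count decreases because [e] is in [w] and in [d] but not in [d']. *)
- apply: leq_trans dn.
  have : (0 < count (pred1 e) w)%N by rewrite -has_count has_pred1.
  suff : (count d' w + count (pred1 e) w <= count d w)%N by lia.
  rewrite -count_predUI [X in (_ + X)%N](@eq_count _ _ pred0).
    rewrite count_pred0 addn0.
    by apply: sub_count => f /= /orP[/and3P[]|/eqP ->].
  by move=> f /=; rewrite /d'; case: eqVneq; rewrite ?andbF.
- apply: leq_trans ty _; apply: sub_count => a /asboolP ya.
  exact/asboolP/yJ.
- apply: leq_trans cov _; apply: sub_count => a /asboolP H; apply/asboolP.
  case: H => [/(sub_connected II)|/vcov[/yJ|/zcov]]; tauto.
Qed.

End Connectivity.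

(** * Summation of tails that contract under tripling *)

Section TailSummation.
Context {R : realType}.
Implicit Types (f g : nat -> R) (a theta : R).

(** The three terms from [3 * s] on are at most [3 * f (3 * s)], hence at most [f s / 2], so the
    tail is at most half of the full sum. Truncation at [3 * k] keeps that sum finite, and its half
    can be absorbed on the left. *)
Lemma sum_tripling f m k : (0 < m)%N -> (m <= k)%N ->
  (forall t, 0 <= f t) -> {homo f : i j / (i <= j)%N >-> j <= i} ->
  (forall t, (m <= t)%N -> f (3 * t)%N <= f t / 6) ->
  \sum_(1 <= t < (3 * k)%N) f t <= 2 * \sum_(1 <= t < (3 * m)%N) f t.
Proof.
move=> m0 mk f0 fh f3.
have tail : \sum_((3 * m)%N <= t < (3 * k)%N) f t <=
    2^-1 * \sum_(m <= t < k) f t.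
  elim: k mk => [|k IH]; first by
    rewrite leqn0 => /eqP ->; rewrite !big_geq// mulr0.
  rewrite leq_eqVlt => /orP[/eqP <-|]; first by rewrite !big_geq// mulr0.
  rewrite ltnS => mk; rewrite (_ : 3 * k.+1 = (3 * k).+3)%N; last by lia.
  rewrite !big_nat_recr//=; [|lia..].
  have := IH mk; have := f3 _ mk; have := fh _ _ (leqnSn (3 * k)).
  have := fh _ _ (leqW (leqnSn (3 * k))).
  lra.
rewrite (@big_cat_nat _ _ _ (3 * m)%N)//=; [|lia..].
have : \sum_(m <= t < k) f t <= \sum_(1 <= t < (3 * k)%N) f t.
  rewrite [leRHS](@big_cat_nat _ _ _ m)//=; [|lia..].
  rewrite [X in _ + X](@big_cat_nat _ _ _ k)//=; [|lia..].
  rewrite addrCA lerDl addr_ge0// sumr_ge0//.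
rewrite [leRHS](@big_cat_nat _ _ _ (3 * m)%N)//=; [|lia..].
lra.
Qed.

(** By induction, the step being [(1 + 1/k)^theta <= 1 + 1/(2k)]. As [theta <= 1/2], the left side
    is at most the square root of [1 + 1/k], and [(1 + 1/(2k))^2] exceeds [1 + 1/k] by a square. *)
Lemma sum_powR_neg theta k : 0 <= theta <= 1 / 2 ->
  \sum_(1 <= t < k.+1) t%:R `^ (- theta) <= 2 * (k%:R * k%:R `^ (- theta)) :> R.
Proof.
move=> /andP[th0 th2]; elim: k => [|k IH].
  by rewrite big_geq// mul0r mulr0.
rewrite big_nat_recr//=.
suff : k%:R * k%:R `^ (- theta) <= (k%:R + 2^-1) * k.+1%:R `^ (- theta) :> R.
  move: IH; set p := k.+1%:R `^ _; rewrite -(natr1 k); lra.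
case: k {IH} => [|k]; first by rewrite mul0r mulr_ge0// powR_ge0.
set x : R := k.+1%:R; have x0 : 0 < x by rewrite ltr0n.
have -> : k.+2%:R = x + 1 :> R by rewrite natr1.
have xx : (x `^ (- theta)) = ((x + 1) / x) `^ theta * (x + 1) `^ (- theta).
  rewrite powRM ?invr_ge0 ?ltW// ?addr_gt0//.
  rewrite mulrAC -powRD; last by apply/implyP => _; lra.
  by rewrite subrr powRr0 mul1r -powR_inv1 ?ltW// -powRrM mulN1r.
rewrite xx mulrA ler_wpM2r ?powR_ge0//.
have y1 : 1 <= (x + 1) / x by rewrite ler_pdivlMr//; lra.
have : ((x + 1) / x) `^ theta <= 1 + (2 * x)^-1.
  apply: (@le_trans _ _ (((x + 1) / x) `^ 2^-1)).
    by apply: ler_powR => //; lra.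
  rewrite powR12_sqrt ?(le_trans ler01 y1)//.
  have q0 : 0 <= 1 + (2 * x)^-1 by rewrite addr_ge0// invr_ge0; lra.
  rewrite -(ger0_norm q0) -sqrtr_sqr ler_wsqrtr// -subr_ge0.
  suff -> : (1 + (2 * x)^-1) ^+ 2 - (x + 1) / x = ((2 * x)^-1) ^+ 2.
    by rewrite sqr_ge0.
  by field; lra.
move=> /(ler_wpM2l (ltW x0)) /le_trans; apply.
by rewrite le_eqVlt; apply/orP; left; apply/eqP; field; lra.
Qed.

(** The constant is [144 = 2 * 2 * 6 * 6]: one 2 from [sum_tripling], one from [sum_powR_neg], and a
    6 from each of [S4] and [S5], where a power of 6 with exponent at most 1 is bounded by 6. *)
Lemma sum_tail_le f g a theta n N : 0 <= theta <= 1 / 2 ->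
  1 <= a -> (0 < n)%N ->
  (forall t, 0 <= f t) -> {homo f : i j / (i <= j)%N >-> j <= i} ->
  (forall t, (0 < t)%N -> f t <= a * t%:R `^ (- theta)) ->
  (forall t, (0 < t)%N -> t%:R * g t <= n%:R * (a * t%:R `^ (- theta))) ->
  (forall t, (0 < t)%N -> f (3 * t)%N <= f t * g t) ->
  \sum_(1 <= t < N.+1) f t <=
    144 * a `^ (2 / (1 + theta)) * n%:R `^ ((1 - theta) / (1 + theta)).
Proof.
move=> th a1 n0 f0 fh fa ga fg.
have /andP[th0 th2] := th.
have n1 : 1 <= n%:R :> R by rewrite ler1n.
have an1 : 1 <= a * n%:R by apply: (le_trans a1); rewrite ler_peMr//; lra.
pose M : R := (6 * (a * n%:R)) `^ ((1 + theta)^-1).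
have M1 : 1 <= M.
  rewrite -(powRr0 (6 * (a * n%:R))); apply: ler_powR; first by lra.
  by rewrite invr_ge0; lra.
have M0 : 0 < M by lra.
(* An integer threshold with [M < m <= 2 * M], the upper bound because [1 <= M]; hence the [6 * M]
   in [S3]. *)
pose m := (Num.trunc M).+1.
have /andP[Mm1 Mm2] := trunc_itv (ltW M0).
have mM : m%:R <= 2 * M :> R by rewrite /m -(natr1 (Num.trunc M)); lra.
have f3 t : (m <= t)%N -> f (3 * t)%N <= f t / 6.
  move=> mt; have t0 : (0 < t)%N by exact: leq_trans mt.
  have tR0 : 0 < t%:R :> R by rewrite ltr0n.
  have Mt : M <= t%:R by apply: (le_trans (ltW Mm2)); rewrite ler_nat.
  apply: le_trans (fg _ t0) _; rewrite ler_wpM2l//.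
  rewrite -(ler_pM2l tR0); apply: le_trans (ga _ t0) _.
  have : 6 * (a * n%:R) <= t%:R * t%:R `^ theta.
    have -> : 6 * (a * n%:R) = M `^ (1 + theta).
      by rewrite /M -powRrM mulVf ?powRr1//; lra.
    rewrite -{1}(powRr1 (ltW tR0)) -powRD; last by
      apply/implyP => _; rewrite gt_eqF.
    by apply: ge0_ler_powR; rewrite ?nnegrE; lra.
  have q0 : 0 < t%:R `^ theta :> R by rewrite powR_gt0.
  by move=> K; rewrite powRN mulrA ler_pdivrMr//; lra.
have NM : (m <= N + m)%N by rewrite leq_addl.
have S1 : \sum_(1 <= t < N.+1) f t <= \sum_(1 <= t < (3 * (N + m))%N) f t.
  rewrite [leRHS](@big_cat_nat _ _ _ N.+1)//=; last by lia.
  by rewrite lerDl sumr_ge0.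
have S2 := sum_tripling (ltn0Sn _) NM f0 fh f3.
have S3 : \sum_(1 <= t < (3 * m)%N) f t <= a * (2 * (6 * M) `^ (1 - theta)).
  apply: (@le_trans _ _ (\sum_(1 <= t < (3 * m)%N.+1) a * t%:R `^ (- theta))).
    rewrite [leRHS]big_nat_recr//= -[leLHS]addr0 lerD//.
      by rewrite !big_nat; apply: ler_sum => t /andP[t0 _]; exact: fa.
    by rewrite mulr_ge0 ?powR_ge0//; lra.
  rewrite -mulr_sumr ler_wpM2l; [by []|lra|].
  apply: le_trans (sum_powR_neg _ th) _; rewrite ler_wpM2l//.
  have m0 : 0 < (3 * m)%:R :> R by rewrite ltr0n.
  rewrite -{1}(powRr1 (ltW m0)) -powRD; last by apply/implyP => _; rewrite gt_eqF.
  by apply: ge0_ler_powR; rewrite ?nnegrE ?natrM; lra.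
have S4 : (6 * M) `^ (1 - theta) <= 6 * M `^ (1 - theta).
  rewrite powRM; [|lra..]; rewrite ler_wpM2r ?powR_ge0//.
  by rewrite -[leRHS]powRr1//; apply: ler_powR; lra.
have ab0 : 0 <= (1 - theta) / (1 + theta) by rewrite divr_ge0; lra.
have S5 : M `^ (1 - theta) <=
    6 * (a `^ ((1 - theta) / (1 + theta)) * n%:R `^ ((1 - theta) / (1 + theta))).
  rewrite /M -powRrM [_^-1 * _]mulrC powRM; [|lra..].
  rewrite [(a * _) `^ _]powRM; [|lra..].
  rewrite ler_wpM2r ?mulr_ge0 ?powR_ge0//.
  rewrite -[leRHS]powRr1//; apply: ler_powR; first by lra.
  by rewrite ler_pdivrMr; lra.
have S6 : a * a `^ ((1 - theta) / (1 + theta)) = a `^ (2 / (1 + theta)).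
  rewrite -{1}(powRr1 (_ : 0 <= a)); last by lra.
  rewrite -powRD; last by apply/implyP => _; lra.
  by congr (_ `^ _); field; lra.
have S7 : a * (2 * (6 * M) `^ (1 - theta)) <= a * (2 * (6 * (6 *
   (a `^ ((1 - theta) / (1 + theta)) * n%:R `^ ((1 - theta) / (1 + theta)))))).
  by rewrite ler_wpM2l; lra.
rewrite -S6; apply: le_trans S1 _; apply: le_trans S2 _.
lra.
Qed.

End TailSummation.

(** * The bound for percolation on finitely many edges *)

Section FinitePercolation.
Context {R : realType} {G : weighted_graph R}.
Variables (p : edge G -> R) (s : seq (edge G)).
Hypothesis p01 : forall e, 0 <= p e <= 1.

Definition open_in (w : seq (edge G)) : edge G -> bool := fun e => e \in w.

Definition cluster_count_ge (L : seq (vertex G)) t u : pred (seq (edge G)) :=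
  fun w => (t <= cluster_count (open_in w) L u)%N.

Definition some_cluster_count_ge L t : pred (seq (edge G)) :=
  fun w => `[< exists v, cluster_count_ge L t v w >].

Lemma increasing_cluster_count_ge L t u : increasing (cluster_count_ge L t u).
Proof.
move=> w w' /mem_subseq ww' /leq_trans; apply.
by apply: le_cluster_count => e; exact: ww'.
Qed.

Lemma increasing_some_cluster_count_ge L t : increasing (some_cluster_count_ge L t).
Proof.
move=> w w' ww' /asboolP[v /(increasing_cluster_count_ge ww') vw].
by apply/asboolP; exists v.
Qed.

(** The splitting starts with every edge in [d] and with [v = u]. Open edges outside the final [d]
    witness the first event, those inside it the second. *)
Lemma split_cluster_count_ge L t u : uniq L -> (0 < t)%N ->
  subpred (cluster_count_ge L (3 * t) u)
    (disjoint_occ (cluster_count_ge L t u) (some_cluster_count_ge L t)).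
Proof.
move=> uL t0 w tw.
have [] := @split_connected_aux _ _ w L t u xpredT u uL t0.
- exact: connected_refl.
- apply: leq_trans (leq_trans tw _); first by lia.
  by apply: le_cluster_count => e; rewrite andbT.
- apply: leq_trans tw _; apply: sub_count => a /asboolP ua; apply/asboolP.
  by right; apply: sub_connected ua => e; rewrite andbT.
move=> d [ud [v vd]]; apply: (@disjoint_occ_filter _ _ _ (predC d)).
  apply: leq_trans ud _; apply: le_cluster_count => e.
  by rewrite /open_in mem_filter andbC.
apply/asboolP; exists v; apply: leq_trans vd _; apply: le_cluster_count => e.
by rewrite /open_in mem_filter /= negbK andbC.
Qed.

(** Layer-cake formula; thresholds beyond [size L] contribute nothing. *)
Lemma cluster_count_sum L u (d : edge G -> bool) :
  (cluster_count d L u)%:R =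
    \sum_(1 <= t < (size L).+1) (t <= cluster_count d L u)%:R :> R.
Proof.
have : (cluster_count d L u <= size L)%N by exact: count_size.
move: (cluster_count d L u) (size L) => k n; elim: n k => [|n IH] k.
  by rewrite leqn0 => /eqP ->; rewrite big_geq.
rewrite leq_eqVlt => /predU1P[->|].
  rewrite (eq_big_nat _ _ (F2 := fun=> 1)).
    by rewrite big_const_nat iter_addr_0 subSS subn0.
  by move=> i /andP[_]; rewrite ltnS => ->.
rewrite ltnS => kn; rewrite big_nat_recr//= -IH//.
by rewrite leqNgt ltnS kn addr0.
Qed.

Lemma sum_connected_le L a theta u : uniq L -> (0 < size L)%N ->
  0 <= theta <= 1 / 2 -> 1 <= a ->
  (forall v t, (0 < t)%N ->
    prob p s (cluster_count_ge L t v) <= a * t%:R `^ (- theta)) ->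
  \sum_(v <- L) prob p s (fun w => `[< connected_in (open_in w) u v >]) <=
    144 * a `^ (2 / (1 + theta)) * (size L)%:R `^ ((1 - theta) / (1 + theta)).
Proof.
move=> uL L0 th a1 H.
rewrite /prob -avg_sum.
have -> : avg p s (fun w => \sum_(v <- L) `[< connected_in (open_in w) u v >]%:R)
    = \sum_(1 <= t < (size L).+1) prob p s (cluster_count_ge L t u).
  rewrite -avg_sum; congr avg; apply/funext => w.
  rewrite -cluster_count_sum /cluster_count -sum1_count natr_sum [RHS]big_mkcond.
  by apply: eq_bigr => v _; case: `[< _ >].
apply: (@sum_tail_le _ _ (fun t => prob p s (some_cluster_count_ge L t))) => //.
- by move=> t; exact: prob_ge0.
- move=> i j ij; apply: le_prob => // w; exact: leq_trans.
- by move=> t t0; exact: H.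
- move=> t t0; rewrite -avgZ.
  apply: (@le_trans _ _ (\sum_(v <- L) prob p s (cluster_count_ge L t v))).
    rewrite /prob -avg_sum; apply: le_avg => // w.
    rewrite -natrM -natr_sum ler_nat.
    (* [v] need not lie in [L], but at least [t] points of [L] are in its cluster, and each of them
       has the same [cluster_count]. *)
    have [/asboolP[v tv]|_] := boolP (some_cluster_count_ge L t w);
      last by rewrite muln0.
    rewrite muln1; apply: (leq_trans (tv : (t <= _)%N)).
    rewrite /cluster_count -sum1_count big_mkcond.
    apply: leq_sum => x _; case: asboolP => // vx.
    by rewrite lt0b /cluster_count_ge -(eq_cluster_count L vx) (tv : (t <= _)%N).
  apply: le_trans (ler_sum _ (fun v _ => H v _ t0)) _.
  by rewrite big_const_seq iter_addr_0 count_predT mulr_natl.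
- move=> t t0; have := le_prob p01 s (@split_cluster_count_ge _ _ u uL t0).
  move=> /le_trans; apply.
  apply: van_den_berg_kesten => //.
  exact: increasing_cluster_count_ge.
  exact: increasing_some_cluster_count_ge.
Qed.

End FinitePercolation.

(** * Cylinder events of the infinite product space *)

Section Cylinders.
Context {R : realType} {G : weighted_graph R}.
Implicit Types (s : seq (edge G)) (Q : pred (seq (edge G))).

(** Links the two models: an event on lists of open edges, read off a full configuration through its
    restriction to [s]. *)
Definition cylinder s Q : set (config (edge G)) :=
  [set w | Q [seq e <- s | (w : edge G -> bool) e]].

Lemma measurable_edge_open (e : edge G) : measurable (edge_open e).
Proof. by apply: sub_gen_smallest; exists e. Qed.

Lemma cylinder_cons e s Q : cylinder (e :: s) Q =
  (edge_open e `&` cylinder s (Q \o cons e)) `|`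
  (cylinder s Q `\` edge_open e).
Proof.
apply/seteqP; split=> w; rewrite /cylinder /edge_open /=;
  case we: ((w : edge G -> bool) e).
- by left.
- by right; split => //; rewrite we.
- by case=> [[]//|[]].
- by case=> [[]//|[]].
Qed.

Lemma measurable_cylinder s Q : measurable (cylinder s Q).
Proof.
elim: s Q => [|e s IH] Q.
  rewrite /cylinder/=; case: (Q [::]).
    by rewrite [X in measurable X](_ : _ = setT)//; apply/seteqP; split.
  by rewrite [X in measurable X](_ : _ = set0)//; apply/seteqP; split.
rewrite cylinder_cons; apply: measurableU.
  by apply: measurableI; [exact: measurable_edge_open|exact: IH].
by apply: measurableD; [exact: IH|exact: measurable_edge_open].
Qed.

Variables (beta : R) (P : probability (config (edge G)) R).
Hypotheses (beta0 : 0 <= beta) (bP : bernoulli_percolation beta P).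

Definition retention (e : edge G) : R := 1 - expR (- (beta * weight e)).

Lemma retention01 e : 0 <= retention e <= 1.
Proof.
rewrite /retention subr_ge0 lerBlDr lerDl expR_ge0 andbT.
by rewrite -expR0 ler_expR oppr_le0 mulr_ge0// ltW// weight_gt0.
Qed.

(** Independence is given for open edges only. The set [T] collects the edges already required to be
    open, and a closed edge is reached by taking a difference, so the induction on [s] must hold for
    all [T]. *)
Lemma probability_opened_cylinder (T : {fset edge G}) s Q : uniq s ->
  (forall e, e \in s -> e \notin T) ->
  P ((\bigcap_(e in [set` T]) edge_open e) `&` cylinder s Q) =
  ((\prod_(e <- T) retention e) * prob retention s Q)%:E.
Proof.
elim: s T Q => [|e s IH] T Q /=.
  move=> _ _; rewrite /prob /= /cylinder /=; case: (Q [::]).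
    rewrite [X in P X](_ : _ = \bigcap_(e in [set` T]) edge_open e).
      rewrite bP.2 mulr1 -prodEFin; apply: eq_bigr => e _; exact: bP.1.
    by apply/seteqP; split=> w //; case.
  rewrite [X in P X](_ : _ = set0) ?measure0 ?mulr0//.
  by apply/seteqP; split=> w //; case.
move=> /andP[es us] sT.
set D := \bigcap_(e in _) _.
have mD : measurable D.
  by apply: fin_bigcap_measurable => // f _; exact: measurable_edge_open.
have eT : e \notin T by apply: sT; rewrite mem_head.
have sT' f : f \in s -> f \notin T by move=> fs; apply: sT; rewrite inE fs orbT.
have sTe f : f \in s -> f \notin (e |` T)%fset.
  move=> fs; rewrite !inE negb_or sT'// andbT.
  by apply: contraNneq es => <-.
have De : \bigcap_(f in [set` (e |` T)%fset]) edge_open f = D `&` edge_open e.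
  apply/seteqP; split=> w.
    move=> H; split=> [f fT|]; apply: H; rewrite /= !inE ?eqxx//.
    by rewrite (fT : f \in T) orbT.
  by move=> [H we] f; rewrite /= !inE => /orP[/eqP ->//|fT]; exact: H.
have H1 := IH (e |` T)%fset (Q \o cons e) us sTe.
have H2 := IH (e |` T)%fset Q us sTe.
have H3 := IH T Q us sT'.
rewrite big_fsetU1//= De in H1 H2.
have mo := measurable_edge_open e.
have mc Q' : measurable (D `&` cylinder s Q').
  by apply: measurableI => //; exact: measurable_cylinder.
have -> : D `&` cylinder (e :: s) Q =
    (D `&` edge_open e `&` cylinder s (Q \o cons e)) `|`
    (D `&` cylinder s Q `\` edge_open e).
  by rewrite cylinder_cons setIUr setIA !setDE setIA.
rewrite measureU//; last 3 first.
- by rewrite setIAC; apply: measurableI.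
- exact: measurableD.
- by apply/seteqP; split=> w // [[[_ +] _] [_]].
(* With [e] closed, the probability is that without a condition on [e] minus that with [e] open;
   both are instances of the induction hypothesis. *)
rewrite measureD//; last by rewrite ltey_eq fin_num_measure.
rewrite (setIAC D (cylinder s Q)).
rewrite [X in X + _]H1 [X in _ + (X - _)%E]H3 [X in _ + (_ - X)%E]H2.
rewrite -EFinB -EFinD.
congr (_%:E); rewrite /prob /=; ring.
Qed.

Lemma probability_cylinder s Q : uniq s ->
  P (cylinder s Q) = (prob retention s Q)%:E.
Proof.
move=> us; have := @probability_opened_cylinder fset0 s Q us.
rewrite big_seq_fset0 mul1r => <-; last by move=> e _; rewrite inE.
by congr (P _); apply/seteqP; split=> w //; case.
Qed.


(** * Exhaustion by finite subgraphs *)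

Definition edges_below n : seq (edge G) :=
  pmap (@pickle_inv (edge G)) (iota 0 n).

(** [pickle_inv] is defined only on genuine codes, so no edge is listed twice. *)
Lemma uniq_edges_below n : uniq (edges_below n).
Proof. by apply: pmap_uniq (iota_uniq 0 n); exact: pickle_invK. Qed.

Lemma mem_edges_below n e : (e \in edges_below n) = (choice.pickle e < n)%N.
Proof.
rewrite mem_pmap; apply/mapP/idP => [[k]|en]; last first.
  by exists (choice.pickle e); rewrite ?mem_iota ?pickleK_inv.
rewrite mem_iota add0n => /andP[_ kn] ek.
by have := @pickle_invK (edge G) k; case: pickle_inv ek => //= f [->] ->.
Qed.

Definition connected_below n u v :=
  cylinder (edges_below n) (fun w => `[< connected_in (open_in w) u v >]).

Lemma connected_belowP n u v (w : config (edge G)) : connected_below n u v w <->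
  connected_in (fun e => (choice.pickle e < n)%N && (w : edge G -> bool) e) u v.
Proof.
rewrite /connected_below /cylinder /=; split.
  move=> /asboolP; apply: sub_connected => e.
  by rewrite /open_in mem_filter mem_edges_below andbC.
move=> c; apply/asboolP; apply: sub_connected c => e.
by rewrite /open_in mem_filter mem_edges_below andbC.
Qed.

Lemma nondecreasing_connected_below u v :
  {homo connected_below ^~ u ^~ v : n m / (n <= m)%N >-> (n <= m)%O}.
Proof.
move=> n m nm; apply/subsetPset => w /connected_belowP c.
apply/connected_belowP; apply: sub_connected c => e /andP[en ->].
by rewrite (leq_trans en nm).
Qed.

(** An open path uses finitely many edges, whose codes have a common bound. *)
Lemma connected_eventE u v :
  connected_event u v = \bigcup_n connected_below n u v.
Proof.
apply/seteqP; split=> w; last first.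
  by move=> [n _ /connected_belowP]; apply: sub_connected => e /andP[].
move=> uv; suff [n c] : exists n, connected_below n u v w by exists n.
move: v uv; apply: connected_ind.
  by exists 0%N; apply/connected_belowP; exact: connected_refl.
move=> y z [n /connected_belowP uy] [e we yz].
exists (maxn n (choice.pickle e).+1); apply/connected_belowP.
apply: (@connected_step _ _ _ y).
  by apply: sub_connected uy => f /andP[fn ->]; rewrite leq_max fn.
by exists e => //; rewrite leq_max leqnn orbT we.
Qed.

Lemma measurable_connected_event u v : measurable (@connected_event R G u v).
Proof.
rewrite connected_eventE; apply: bigcupT_measurable => n.
exact: measurable_cylinder.
Qed.

End Cylinders.

(** * Measurability of cluster sizes, and passage to the limit *)

Lemma le_countingP {T : choiceType} {R : realType} (A : set T) (lam : R) :
  (lam%:E <= counting A)%E <->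
  exists2 F : {fset T}, [set` F] `<=` A & lam <= #|` F|%:R.
Proof.
rewrite /counting; case: asboolP => [fA|infA]; last first.
  split=> [_|_]; last exact: leey.
  (* An infinite set has finite subsets of every size; [lam] may be negative, hence the absolute
     value. *)
  have [F FA lF] := infinite_set_fset (Num.trunc `|lam|).+1 infA.
  exists F => //; apply: (@le_trans _ _ (Num.trunc `|lam|).+1%:R).
    apply: (le_trans (ler_norm lam)); apply/ltW.
    by have /andP[] := trunc_itv (normr_ge0 lam).
  by rewrite ler_nat.
rewrite lee_fin; split=> [lA|[F FA lF]].
  by exists (fset_set A) => //; rewrite fset_setK.
apply: le_trans lF _; rewrite ler_nat fsubset_leq_card//.
by apply/fsubsetP => x xF; rewrite in_fset_set// inE; exact: FA.
Qed.

(** A large cluster is witnessed by a finite set of vertices, and there are countably many of these,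
    enumerated by their codes. *)
Lemma measurable_cluster_ge {R : realType} (G : weighted_graph R) u lam :
  measurable (@cluster_ge R G u lam).
Proof.
pose B (F : {fset vertex G}) := \bigcap_(x in [set` F]) @connected_event R G u x.
pose C n := if @choice.unpickle {fset vertex G} n is Some F then
  if lam <= #|` F|%:R then B F else set0 else set0.
have -> : @cluster_ge R G u lam = \bigcup_n C n.
  apply/seteqP; split=> w.
    move=> /le_countingP[F Fu lF]; exists (choice.pickle F) => //.
    by rewrite /C choice.pickleK lF.
  move=> [n _]; rewrite /C; case: choice.unpickle => // F.
  by case: ifP => // lF BF; apply/le_countingP; exists F.
apply: bigcupT_measurable => n; rewrite /C; case: choice.unpickle => // F.
case: ifP => // _; apply: fin_bigcap_measurable => // x _.
exact: measurable_connected_event.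
Qed.

Theorem theorem2p1 (R : realType) :
  exists C : R,
  forall (G : weighted_graph R) (beta : R), 0 <= beta ->
  forall P : probability (config (edge G)) R,
  bernoulli_percolation beta P ->
  forall A theta : R, 0 <= theta <= 1 / 2 ->
  (forall (u : vertex G) (lam : R), 0 < lam ->
     (P (cluster_ge u lam) <= (A * lam `^ (- theta))%:E)%E) ->
  forall (u : vertex G) (L : {fset vertex G}), L != fset0 ->
  ((#|` L|%:R^-1)%:E * \sum_(v <- L) P (connected_event u v) <=
   (C * A `^ (2 / (1 + theta))
      * #|` L|%:R `^ (- (2 * theta / (1 + theta))))%:E)%E.
Proof.
exists 144 => G beta beta0 P bP A theta th tail u L L0.
have L1 : (0 < #|` L|)%N by rewrite cardfs_gt0.
have LR : 0 < #|` L|%:R :> R by rewrite ltr0n.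
(* Every cluster contains its root, so the tail hypothesis at [lam = 1] forces this. *)
have A1 : 1 <= A.
  have := tail u 1 ltr01; rewrite powR1 mulr1.
  rewrite (_ : cluster_ge u 1 = setT) ?probability_setT ?lee_fin//.
  apply/seteqP; split=> w // _; apply/le_countingP.
  exists [fset u]%fset; last by rewrite cardfs1.
  by move=> x /=; rewrite inE => /eqP ->; exact: connected_refl.
(* Keeping finitely many edges and counting only points of [L] can only lower the size, so the
   hypothesis carries over uniformly in [n]. *)
have fin_tail n v t : (0 < t)%N ->
    prob (retention beta) (edges_below n) (cluster_count_ge L t v) <=
    A * t%:R `^ (- theta).
  move=> t0; rewrite -lee_fin -(probability_cylinder bP) ?uniq_edges_below//.
  apply: (@le_trans _ _ (P (cluster_ge v t%:R))); last by rewrite tail// ltr0n.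
  apply: le_measure; rewrite ?inE; first exact: measurable_cylinder.
    exact: measurable_cluster_ge.
  move=> w tw; apply/le_countingP.
  exists [fset x in L | `[< connected_in (w : edge G -> bool) v x >]]%fset.
    by move=> x /=; rewrite !inE => /andP[_ /asboolP].
  rewrite ler_nat; apply: (leq_trans (tw : (t <= _)%N)).
  rewrite /cluster_count -size_filter uniq_leq_size ?filter_uniq ?fset_uniq// => x.
  rewrite mem_filter !inE => /andP[/asboolP vx ->]; apply/asboolP.
  by apply: sub_connected vx => e; rewrite /open_in mem_filter => /andP[].
have fin_bound n : (\sum_(v <- L) P (connected_below n u v) <=
    (144 * A `^ (2 / (1 + theta)) * #|` L|%:R `^ ((1 - theta) / (1 + theta)))%:E)%E.
  under eq_bigr do rewrite (probability_cylinder bP) ?uniq_edges_below//.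
  rewrite sumEFin lee_fin; apply: sum_connected_le => //.
  - exact: retention01.
  - exact: fset_uniq.
  - by move=> v t t0; exact: fin_tail.
have bound : (\sum_(v <- L) P (connected_event u v) <=
    (144 * A `^ (2 / (1 + theta)) * #|` L|%:R `^ ((1 - theta) / (1 + theta)))%:E)%E.
  (* Continuity from below along the increasing events [connected_below n u v], the bound being
     uniform in [n]. *)
  suff cv : (\sum_(v <- L) P (connected_below n u v))%E @[n --> \oo] -->
      (\sum_(v <- L) P (connected_event u v))%E.
    by apply: cvge_le cv; apply: nearW => n; exact: fin_bound.
  apply: cvg_nnesum => v _; first by apply: nearW => n; exact: measure_ge0.
  rewrite connected_eventE; apply: nondecreasing_cvg_mu.
  - by move=> n; exact: measurable_cylinder.
  - by rewrite -connected_eventE; exact: measurable_connected_event.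
  - exact: nondecreasing_connected_below.
apply: (le_trans (lee_wpmul2l _ bound)); first by rewrite lee_fin invr_ge0 ltW.
rewrite -EFinM lee_fin mulrCA ler_wpM2l//.
  by rewrite mulr_ge0 ?powR_ge0.
(* Exponents of the cardinality: [(1 - theta) / (1 + theta) - 1 = - 2 theta / (1 + theta)]. *)
rewrite -(powR_inv1 (ltW LR)) -powRD; last by apply/implyP => _; rewrite gt_eqF.
by rewrite le_eqVlt; apply/orP; left; apply/eqP; congr (_ `^ _); field; lra.
Qed.
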